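(* Let $\Gamma$ be a finitely generated group. Then among free p.m.p. actions of $\Gamma$, the cost is maximal on free factors of i.i.d.: if $f$ is any free p.m.p. action of $\Gamma$ and $g$ is any free p.m.p. action of $\Gamma$ that is a factor of a Bernoulli action of $\Gamma$, then $\mathrm{cost}(f)\le\mathrm{cost}(g)$. In particular, all free factors of i.i.d. of $\Gamma$ have the same cost.
   Context: A p.m.p. (probability measure preserving) action $f$ of a countable group $\Gamma$ on a standard Borel probability space $(X,\mathcal{B},\mu)$ assigns to each $\gamma\in\Gamma$ a measure preserving Borel transformation $f_\gamma$ of $X$, with $f_{\gamma\delta}=f_\gamma f_\delta$. The action $f$ is free if for $\mu$-almost every $x\in X$ and all $\gamma\neq\gamma'\in\Gamma$ we have $f_\gamma(x)\neq f_{\gamma'}(x)$. For a standard probability space $\kappa$, the Bernoulli action $\kappa^{\Gamma}$ is the set of maps from $\Gamma$ to $\kappa$ with the product measure and the shift action of $\Gamma$, $(\delta\cdot\omega)(\gamma)=\omega(\gamma\delta)$. A p.m.p. action $g$ on $(Y,\mathcal{C},\nu)$ is a factor of $f$ on $(X,\mathcal{B},\mu)$ if there is a surjective measure preserving $\Gamma$-equivariant map from $X$ to $Y$ (up to null sets). A free factor of i.i.d. is a free p.m.p. action that is a factor of some Bernoulli action of $\Gamma$. Cost: let $R_f=\{(x,f_\gamma x)\mid x\in X,\gamma\in\Gamma\}$ be the orbit equivalence relation of a p.m.p. action $f$. A graphing in $R_f$ is a countable family of measure preserving Borel bijections $\varphi_i:A_i\to B_i$ between Borel subsets of $X$ with $(x,\varphi_i(x))\in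 R_f$ for all $x\in A_i$. It generates $R_f$ if, up to a null set, $R_f$ is the smallest equivalence relation containing all pairs $(x,\varphi_i(x))$. The cost of the graphing is $\sum_i\mu(A_i)$, and $\mathrm{cost}(f)$ is the infimum of the costs of all graphings generating $R_f$. *)

(* Defs.v *)
From mathcomp Require Import all_boot all_order all_algebra.
From mathcomp Require Import finmap.
From mathcomp Require Import all_classical all_reals all_analysis.
From Stdlib Require Import RelationClasses.

Set Implicit Arguments.
Unset Strict Implicit.
Unset Printing Implicit Defensive.

Local Open Scope classical_set_scope.
Local Open Scope ereal_scope.

(* Predicates on Gamma range over all subsets, by classical logic. *)
Definition finitely_generated (Gamma : groupType) : Prop :=
  exists S : {fset Gamma}, forall H : {pred Gamma},
    group_closed H -> {subset S <= H} -> forall x, x \in H.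

(* A complete pseudometric that is Hausdorff is a complete metric, so [Y]
   below is a Polish space and [<<s open >>] is its Borel sigma-algebra. *)
Definition standard_borel (R : realType) (d : measure_display)
    (X : measurableType d) : Prop :=
  exists Y : completePseudoMetricType R,
    [/\ hausdorff_space Y,
        exists2 D : set Y, countable D & dense D
      & exists2 phi : X -> Y, bijective phi &
          forall A : set Y, measurable (phi @^-1` A) <-> <<s open >> A].

Record pmp_action (R : realType) (Gamma : groupType) (d : measure_display)
    (X : measurableType d) (mu : probability X R) (f : Gamma -> X -> X)
    : Prop := PmpAction {
  pmp_standard : standard_borel R X ;
  pmp_measurable : forall g, measurable_fun setT (f g) ;
  pmp_preserving : forall g A, measurable A -> mu (f g @^-1` A) = mu A ;
  pmp_one : forall x, f 1%g x = x ;
  pmp_mul : forall g h x, f (g * h)%g x = f g (f h x) }.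

Definition free_action (R : realType) (Gamma : groupType)
    (d : measure_display) (X : measurableType d) (mu : probability X R)
    (f : Gamma -> X -> X) : Prop :=
  {ae mu, forall x, forall g h : Gamma, g <> h -> f g x <> f h x}.

(* Since [phi] is total, a map given on a conull set is to be extended by a
   constant. *)
Definition is_factor (R : realType) (Gamma : groupType)
    (d : measure_display) (X : measurableType d) (mu : probability X R)
    (f : Gamma -> X -> X)
    (e : measure_display) (Y : measurableType e) (nu : probability Y R)
    (g : Gamma -> Y -> Y) : Prop :=
  exists phi : X -> Y,
    [/\ measurable_fun setT phi,
        forall B, measurable B -> mu (phi @^-1` B) = nu B,
        nu.-negligible (~` range phi)
      & {ae mu, forall x, forall c : Gamma, phi (f c x) = g c (phi x)}].

Definition cylinders (Gamma : Type) (d : measure_display)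
    (K : measurableType d) : set (set (Gamma -> K)) :=
  [set C | exists (c : Gamma) (A : set K),
    measurable A /\ C = [set w | A (w c)]].

(* [Gamma -> K] with the product sigma-algebra. *)
Notation product_space Gamma K := (g_sigma_algebraType (@cylinders Gamma _ K)).

(* These values on finite-dimensional boxes determine the product measure. *)
Definition is_product_measure (R : realType) (Gamma : groupType)
    (d : measure_display) (K : measurableType d) (kappa : probability K R)
    (P : probability (product_space Gamma K) R) : Prop :=
  forall (F : {fset Gamma}) (A : Gamma -> set K),
    (forall c, measurable (A c)) ->
    P [set w | forall c, c \in F -> A c (w c)] = \prod_(c <- F) kappa (A c).

Definition bernoulli_shift (Gamma : groupType) (K : Type) :
    Gamma -> (Gamma -> K) -> (Gamma -> K) :=
  fun delta w c => w (c * delta)%g.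

Definition bernoulli_factor (R : realType) (Gamma : groupType)
    (d : measure_display) (Y : measurableType d) (nu : probability Y R)
    (g : Gamma -> Y -> Y) : Prop :=
  exists (e : measure_display) (K : measurableType e) (kappa : probability K R)
         (P : probability (product_space Gamma K) R),
    [/\ standard_borel R K, is_product_measure kappa P
      & is_factor P (@bernoulli_shift Gamma K) nu g].

Definition free_factor_of_iid (R : realType) (Gamma : groupType)
    (d : measure_display) (Y : measurableType d) (nu : probability Y R)
    (g : Gamma -> Y -> Y) : Prop :=
  [/\ pmp_action nu g, free_action nu g & bernoulli_factor nu g].

Definition orbit_rel (Gamma X : Type) (f : Gamma -> X -> X) : set (X * X) :=
  [set xy | exists c : Gamma, xy.2 = f c xy.1].

(* The domain and codomain are [A] and [B]; values of [phi] off [A] are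
   irrelevant. *)
Record partial_mp_bijection (R : realType) (d : measure_display)
    (X : measurableType d) (mu : probability X R) (A B : set X)
    (phi : X -> X) : Prop := PartialMpBijection {
  pmb_dom : measurable A ;
  pmb_cod : measurable B ;
  pmb_bij : set_bij A B phi ;
  pmb_measurable : measurable_fun A phi ;
  pmb_inv_measurable : forall C, measurable C -> C `<=` A ->
    measurable (phi @` C) ;
  pmb_preserving : forall C, measurable C -> C `<=` A ->
    mu (phi @` C) = mu C }.

(* Finite families are padded with empty partial maps, which add neither
   pairs nor cost. *)
Record graphing_data (X : Type) := GraphingData {
  gdom : nat -> set X ;
  gcod : nat -> set X ;
  gmap : nat -> X -> X }.

Definition graphing_pairs (X : Type) (Phi : graphing_data X) : set (X * X) :=
  [set xy | exists i, gdom Phi i xy.1 /\ xy.2 = gmap Phi i xy.1].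

Definition is_graphing (R : realType) (Gamma : groupType)
    (d : measure_display) (X : measurableType d) (mu : probability X R)
    (f : Gamma -> X -> X) (Phi : graphing_data X) : Prop :=
  (forall i, partial_mp_bijection mu (gdom Phi i) (gcod Phi i) (gmap Phi i))
  /\ graphing_pairs Phi `<=` orbit_rel f.

Definition generated_rel (X : Type) (Phi : graphing_data X) : set (X * X) :=
  smallest [set E | Equivalence (fun x y => E (x, y))] (graphing_pairs Phi).

(* Gamma being countable, the saturation of a null set is null; hence it does
   not matter whether [y] is also required to avoid the null set. *)
Definition generates (R : realType) (Gamma : groupType)
    (d : measure_display) (X : measurableType d) (mu : probability X R)
    (f : Gamma -> X -> X) (Phi : graphing_data X) : Prop :=
  {ae mu, forall x, forall y, orbit_rel f (x, y) <-> generated_rel Phi (x, y)}.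

Definition graphing_cost (R : realType) (d : measure_display)
    (X : measurableType d) (mu : probability X R) (Phi : graphing_data X)
    : \bar R :=
  \sum_(0 <= i <oo) mu (gdom Phi i).

Definition cost (R : realType) (Gamma : groupType) (d : measure_display)
    (X : measurableType d) (mu : probability X R) (f : Gamma -> X -> X)
    : \bar R :=
  ereal_inf [set c | exists2 Phi : graphing_data X,
    is_graphing mu f Phi /\ generates mu f Phi & c = graphing_cost mu Phi].

(* Main.v *)
(* Let [B] be the edge sets of a graphing of the factor of i.i.d. [g], cut up
   so that each edge is labelled by a group element. Up to [eps] only finitely
   many edge sets matter, provided that one adds, for each generator [s], the
   edges from [y] to [s y] at those [y] for which a finite part of the graph,
   read in the group by freeness, does not join [1] to [s]. The cost of the
   enlarged graphing is then the integral of a function of finitely many bits,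
   the pattern of the edge sets along the orbit, and any family of sets, in any
   action, yields a generating graphing through the same recipe. So it suffices
   to find sets in the space of [f] whose expected pattern cost is at most that
   of [B] plus [eps]; in contrast with weak containment, only this one number
   has to be controlled. Approximate [B] by sets which read finitely many
   labels of the Bernoulli shift, partition [X] finitely so that the relevant
   translates of most points lie in distinct cells, and colour the cells
   independently: the expectation of the cost over the colourings is the cost
   in the Bernoulli shift, up to [eps], hence some colouring does as well.
   Atoms of [X] do no harm, so finite groups need no separate treatment. *)
Require Import Defs.
From mathcomp Require Import all_boot all_order all_algebra.
From mathcomp Require Import finmap.
From mathcomp Require Import all_classical all_reals all_analysis.
From mathcomp Require Import measurable_realfun.
From Stdlib Require Import RelationClasses.

Set Implicit Arguments.
Unset Strict Implicit.
Unset Printing Implicit Defensive.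

Import Order.TTheory GRing.Theory Num.Theory.

Local Open Scope classical_set_scope.
Local Open Scope ereal_scope.

(** * Maps with finitely many values *)

(** Measurability of a finite-valued map is asked fibre by fibre, so that no sigma-algebra on the
    target has to be carried along. *)
Definition measurable_fibers (d : measure_display) (X : measurableType d)
    (I : Type) (q : X -> I) : Prop :=
  forall i, measurable (q @^-1` [set i]).

Section MeasurableFibers.
Context (d : measure_display) (X : measurableType d).

Lemma measurable_fibers_preimage (I : finType) (q : X -> I) (A : set I) :
  measurable_fibers q -> measurable (q @^-1` A).
Proof.
move=> mq.
have -> : q @^-1` A = \bigcup_(i in A) (q @^-1` [set i]).
  by apply/seteqP; split=> [x Ax|x [i Ai /= qx]]; [exists (q x)|rewrite /= qx].
apply: fin_bigcup_measurable => // i _; exact: mq.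
Qed.

Lemma measurable_fibers_comp (I : finType) (J : Type) (q : X -> I)
    (r : I -> J) :
  measurable_fibers q -> measurable_fibers (r \o q).
Proof.
by move=> mq j; exact: (measurable_fibers_preimage (r @^-1` [set j])).
Qed.

Lemma measurable_fibers_asbool (A : set X) :
  measurable A -> measurable_fibers (fun x => `[< A x >]).
Proof.
move=> mA [].
  have -> : (fun x => `[< A x >]) @^-1` [set true] = A => //.
  by apply/seteqP; split=> x /= /asboolP.
have -> : (fun x => `[< A x >]) @^-1` [set false] = ~` A.
  by apply/seteqP; split=> x /=; [move=> /asboolPn|move=> ?; apply/asboolPn].
exact: measurableC.
Qed.

Lemma measurable_fibers_dffun (T : finType) (I : T -> finType)
    (q : forall t, X -> I t) :
  (forall t, measurable_fibers (q t)) ->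
  measurable_fibers (fun x => [ffun t => q t x] : {dffun forall t, I t}).
Proof.
move=> mq a.
have -> : (fun x => [ffun t => q t x] : {dffun forall t, I t}) @^-1` [set a]
    = \bigcap_(t in [set: T]) (q t @^-1` [set a t]).
  apply/seteqP; split=> x /= => [<- t _ /=|ax]; first by rewrite ffunE.
  by apply/ffunP => t; rewrite ffunE; exact: ax.
apply: fin_bigcap_measurable => // t _; exact: mq.
Qed.

Lemma measurable_fibers_ffun (T I : finType) (q : T -> X -> I) :
  (forall t, measurable_fibers (q t)) ->
  measurable_fibers (fun x => [ffun t => q t x]).
Proof.
move=> mq a.
have -> : (fun x => [ffun t => q t x]) @^-1` [set a]
    = \bigcap_(t in [set: T]) (q t @^-1` [set a t]).
  apply/seteqP; split=> x /= => [<- t _ /=|ax]; first by rewrite ffunE.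
  by apply/ffunP => t; rewrite ffunE; exact: ax.
apply: fin_bigcap_measurable => // t _; exact: mq.
Qed.

Lemma measurable_fibers_precomp (e : measure_display) (Y : measurableType e)
    (I : Type) (f : Y -> X) (q : X -> I) :
  measurable_fun setT f -> measurable_fibers q -> measurable_fibers (q \o f).
Proof.
move=> mf mq i; rewrite -[X in measurable X]setTI.
exact: (mf measurableT _ (mq i)).
Qed.

Lemma measurable_fun_fibers (I : finType) (q : X -> I)
    (e : measure_display) (Y : measurableType e) (h : I -> Y) :
  measurable_fibers q -> measurable_fun setT (fun x => h (q x)).
Proof.
move=> mq _ B mB; rewrite setTI.
rewrite (_ : _ @^-1` B = q @^-1` (h @^-1` B))//.
exact: measurable_fibers_preimage.
Qed.

End MeasurableFibers.

(** Continuity from above. The bound holds from [N] on, so that finitely many such families admit a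
    common index. *)
Lemma nonincreasing_measure_small (R : realType) (d : measure_display)
    (X : measurableType d) (mu : probability X R) (F : nat -> set X)
    (eps : R) :
  (0 < eps)%R -> (forall n, measurable (F n)) ->
  (forall m n, (m <= n)%N -> F n `<=` F m) ->
  mu.-negligible (\bigcap_n F n) ->
  exists N, forall n, (N <= n)%N -> mu (F n) <= eps%:E.
Proof.
move=> e0 mF niF F0.
have mcap : measurable (\bigcap_n F n) by exact: bigcap_measurable.
have cap0 : mu (\bigcap_n F n) = 0 by exact/negligibleP.
have : mu \o F @ \oo --> mu (\bigcap_n F n).
  apply: nonincreasing_cvg_mu => //; last first.
    by move=> m n mn; apply/subsetPset; exact: niF.
  exact: (le_lt_trans (probability_le1 _ _) (ltry 1)).
rewrite cap0 => /fine_cvgP [fF /cvgrPdist_le /(_ eps e0) [N _ HN]].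
case: fF => N' _ HN'.
exists (maxn N N') => n; rewrite geq_max => /andP[Nn N'n].
have /= := HN n Nn; rewrite sub0r normrN ger0_norm ?fine_ge0// => le_eps.
by rewrite -lee_fin fineK// in le_eps; exact: HN'.
Qed.

(** Small balls about the points of a countable dense set separate points. Finitely many of these
    sets cut the space into finitely many cells, which is how points are approximated below. *)
Lemma standard_borel_separation (R : realType) (d : measure_display)
    (X : measurableType d) :
  standard_borel R X ->
  exists D : nat -> set X, (forall n, measurable (D n)) /\
    forall x y, x <> y -> exists n, D n x /\ ~ D n y.
Proof.
move=> [Y [hY [D cD dD] [phi bphi mphi]]].
have [c cinj] : exists c : Y -> nat, {in D &, injective c}.
  by move: cD => /countable_injP [c]; exists c.
(* The union has at most one member, [c] being injective on [D]; it indexes the balls by numbers.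
   Interiors are taken because a [ball] need not be open. *)
pose O n m : set Y :=
  \bigcup_(z in [set z | D z /\ c z = n]) interior (ball z (m.+1%:R^-1 : R)).
have mO n m : measurable (phi @^-1` O n m).
  apply/mphi; apply: sub_sigma_algebra.
  by apply: bigcup_open => z _; exact: open_interior.
have sep x y : x <> y -> exists n m, O n m (phi x) /\ ~ O n m (phi y).
  move=> xy.
  have /eqP nxy : phi x <> phi y by move=> /(bij_inj bphi).
  have [r r0 hr] : exists2 r : R, (0 < r)%R & ~ ball (phi x) r (phi y).
    move: hY; rewrite ball_hausdorff => /(_ _ _ nxy) [[r1 r2] /= /eqP r12].
    exists r1%:num%R => // bxy; move: r12; apply/eqP/set0P.
    exists (phi y); split => //; exact: ballxx.
  have [m hm] : exists m : nat, ((m.+1%:R^-1 : R) < r / 2)%R.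
    have r20 : (0 < r / 2)%R by rewrite divr_gt0.
    have [N _ /(_ N)/(_ (leqnn _)) HN] := near_infty_natSinv_lt (PosNum r20).
    by exists N.
  (* If [z] is within [s] of [phi x], then [phi x] is interior to the ball about [z] of radius
     [2 s]; were [phi y] in that ball, it would lie within [3 s <= r] of [phi x]. *)
  pose s : R := (m.+1%:R^-1 / 2)%R.
  have s0 : (0 < s)%R by rewrite divr_gt0.
  have m0 : (0 < m.+1%:R^-1 :> R)%R by [].
  have [z [bz Dz]] : interior (ball (phi x) s) `&` D !=set0.
    apply: dD; last exact: open_interior.
    by exists (phi x); exact: nbhsx_ballx.
  have {}bz : ball z s (phi x).
    by apply: ball_sym; exact: interior_subset bz.
  exists (c z), m; split.
    exists z => //; apply: (@filterS _ (nbhs (phi x)) _ (ball (phi x) s)).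
      move=> w bw; rewrite (splitr m.+1%:R^-1); exact: ball_triangle bz bw.
    exact: nbhsx_ballx.
  move=> [z' [Dz' cz'] bz']; apply: hr.
  have zz' : z' = z by apply: cinj; rewrite ?inE.
  have {}bz' : ball z m.+1%:R^-1 (phi y).
    by rewrite -zz'; exact: interior_subset.
  apply: (@le_ball _ _ _ (s + m.+1%:R^-1)); last first.
    exact: ball_triangle (ball_sym bz) bz'.
  rewrite (splitr r) lerD//; last exact: ltW.
  by apply: le_trans (ltW hm); rewrite /s ler_pdivrMr// ler_peMr// ler1n.
exists (fun n => let p := odflt (0%N, 0%N) (choice.unpickle n) in phi @^-1` O
  p.1 p.2).
split=> [n|x y /sep [n [m H]]]; first exact: mO.
by exists (choice.pickle (n, m)); rewrite choice.pickleK.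
Qed.

(** Integrals become finite sums of reals, which can be averaged over colourings. *)
Lemma integral_fibers (R : realType) (d : measure_display)
    (X : measurableType d) (mu : probability X R) (I : finType) (q : X -> I)
    (h : I -> R) :
  measurable_fibers q -> (forall i, 0 <= h i)%R ->
  \int[mu]_x (h (q x))%:E = (\sum_i h i * fine (mu (q @^-1` [set i])))%:E.
Proof.
move=> mq h0.
have indicE' i x : (\1_(q @^-1` [set i]) x = (q x == i)%:R :> R)%R.
  rewrite indicE; congr (_%:R)%R; congr nat_of_bool.
  by apply/idP/eqP; rewrite inE.
have mindic i : measurable_fun setT (fun x => (\1_(q @^-1` [set i]) x : R)%:E).
  under eq_fun do rewrite indicE'.
  exact: (measurable_fun_fibers (fun j => (j == i)%:R%:E : \bar R) mq).
have -> : (fun x => (h (q x))%:E) =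
    (fun x => \sum_(i : I) (h i)%:E * (\1_(q @^-1` [set i]) x)%:E).
  apply/funext => x; rewrite (bigD1 (q x))//= big1 ?adde0.
    by rewrite indicE mem_set//= mule1.
  by move=> i /eqP iq; rewrite indicE memNset ?mule0// => /esym.
rewrite ge0_integral_sum//; first last.
- by move=> i x _; rewrite mule_ge0// lee_fin.
- by move=> i; apply: measurable_funeM.
rewrite -sumEFin; apply: eq_bigr => i _.
rewrite ge0_integralZl_EFin//.
by rewrite integral_indic// setIT EFinM fineK// fin_num_measure.
Qed.

Lemma sum_fibers (R : realType) (d : measure_display)
    (X : measurableType d) (mu : probability X R) (I : finType) (q : X -> I) :
  measurable_fibers q -> (\sum_i fine (mu (q @^-1` [set i])) = 1)%R.
Proof.
move=> mq; have := @integral_fibers _ _ _ mu _ _ (fun=> 1%R) mq.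
move=> /(_ (fun=> ler01)) H.
move: H; rewrite integral_cst// mul1e [X in X = _ -> _]probability_setT.
by under eq_bigr do rewrite mul1r; move=> [].
Qed.

Lemma integral_bool (R : realType) (d : measure_display)
    (X : measurableType d) (mu : probability X R) (b : X -> bool) :
  measurable_fibers b -> \int[mu]_x ((b x)%:R)%:E = mu [set x | b x].
Proof.
move=> mb.
have -> : [set x | b x] = b @^-1` [set true] by [].
rewrite (integral_fibers mu (h := fun c : bool => c%:R%R) mb)//.
by rewrite big_bool/= mulr1n mulr0n mul1r mul0r addr0 fineK// fin_num_measure.
Qed.

(** * Random colourings *)

Section RandomColouring.
Local Open Scope ring_scope.
Context (R : realType) (J I : finType) (p : I -> R).
Hypotheses (p0 : forall i, 0 <= p i) (p1 : \sum_i p i = 1).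

(** The probability of [c] when the cells in [J] are coloured independently with law [p]. *)
Let wt (c : {ffun J -> I}) : R := \prod_j p (c j).

Lemma sum_colouring_weight : \sum_c wt c = 1.
Proof. by rewrite /wt -(bigA_distr_bigA (fun _ => p)) big1. Qed.

(** Colours read at distinct cells are again independent with law [p]: the colours of the cells
    outside the image of [v] sum out to 1. *)
Lemma sum_colouring_injective (W : finType) (v : W -> J)
    (G : {ffun W -> I} -> R) : injective v ->
  \sum_c wt c * G [ffun w => c (v w)] = \sum_a G a * \prod_w p (a w).
Proof.
move=> vinj.
rewrite (partition_big (fun c : {ffun J -> I} => [ffun w => c (v w)])
  xpredT)//=.
apply: eq_bigr => a _.
rewrite (eq_bigr (fun c => G a * wt c)); last by move=> c /eqP ->; rewrite
  mulrC.
rewrite -big_distrr/=; congr (_ * _).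
(* The colours that [a] permits at the cell [j]. The colourings that read [a] thus form a product
   set, and the sum of products turns into a product of sums. *)
pose F j : pred I := [pred i | [forall w, (v w == j) ==> (i == a w)]].
rewrite (eq_bigl (fun c => c \in family F)); last first.
  move=> c; apply/eqP/familyP => [ca j|Fc].
    rewrite inE; apply/forallP => w; apply/implyP => /eqP <-.
    by rewrite -ca ffunE.
  apply/ffunP => w; rewrite ffunE; have := Fc (v w).
  by rewrite inE => /forallP /(_ w); rewrite eqxx => /eqP.
rewrite -(bigA_distr_big_dep _ (fun _ => p)).
rewrite (bigID (fun j => j \in [set v w | w in [set: W]]%SET))/= mulrC big1;
  last first.
  move=> j jv; rewrite -[RHS]p1; apply: eq_bigl => i.
  apply/forallP => w; apply/implyP => /eqP vw.
  by move: jv; rewrite -vw => /negP[]; apply/imsetP; exists w.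
rewrite mul1r big_imset/=; last by move=> ? ? _ _; exact: vinj.
rewrite big_mkcond/=; apply: eq_bigr => w _; rewrite inE.
rewrite (big_pred1 (a w))// => i; apply/forallP/eqP => [/(_ w)|-> w'].
  by rewrite eqxx => /eqP.
by apply/implyP => /eqP /vinj ->.
Qed.

(** First moment method: the colouring of least cost does no worse than the mean. [i0] ensures that
    there is a colouring. *)
Lemma colouring_le_average (V : finType) (m : V -> R) (H : V -> {ffun J -> I}
  -> R)
    (T : V -> R) (i0 : I) :
  (forall v, 0 <= m v) ->
  (forall v, \sum_c wt c * H v c <= T v) ->
  exists c, \sum_v H v c * m v <= \sum_v T v * m v.
Proof.
move=> m0 HT; pose A c := \sum_v H v c * m v.
pose c0 := [arg min_(c < [ffun=> i0] : {ffun J -> I}) A c]%O.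
have c0P c : A c0 <= A c by rewrite /c0; case: arg_minP => // c' _; exact.
exists c0; rewrite -[leLHS]mul1r -sum_colouring_weight mulr_suml.
apply: (@le_trans _ _ (\sum_c wt c * A c)).
  by apply: ler_sum => c _; rewrite ler_wpM2l ?c0P// prodr_ge0.
under eq_bigr do rewrite mulr_sumr.
rewrite exchange_big/=; apply: ler_sum => v _.
under eq_bigr do rewrite mulrA.
by rewrite -mulr_suml ler_wpM2r.
Qed.

End RandomColouring.

(** * Functions of finitely many coordinates *)

Definition depends_on (G : choiceType) (I : Type) (T : Type) (W : {fset G})
    (h : (G -> I) -> T) : Prop :=
  forall a b, (forall g, g \in W -> a g = b g) -> h a = h b.

Section Windows.
Context (G : choiceType) (W : {fset G}) (I : finType) (i0 : I).

(** The value [i0] off [W] is arbitrary; a function that depends on [W] does not see it. *)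
Definition extend (a : {ffun W -> I}) (g : G) : I :=
  if insub g is Some w then a w else i0.

Definition window (b : G -> I) : {ffun W -> I} := [ffun w => b (val w)].

Lemma extendE (a : {ffun W -> I}) (w : W) : extend a (val w) = a w.
Proof. by rewrite /extend valK. Qed.

Lemma extend_window (T : Type) (h : (G -> I) -> T) (b : G -> I) :
  depends_on W h -> h (extend (window b)) = h b.
Proof. by apply=> g gW; rewrite -[g]/(val [` gW]%fset) extendE ffunE. Qed.

Lemma depends_on_fibers (d : measure_display) (X : measurableType d)
    (T : Type) (F : G -> X -> I) (h : (G -> I) -> T) :
  (forall g, measurable_fibers (F g)) -> depends_on W h ->
  measurable_fibers (fun x => h (F^~ x)).
Proof.
move=> mF hW.
have -> : (fun x => h (F^~ x)) = (fun a => h (extend a)) \o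
    (fun x => window (F^~ x)).
  by apply/funext => x /=; rewrite extend_window.
by apply: measurable_fibers_comp; exact: measurable_fibers_ffun.
Qed.

End Windows.

Lemma coordinate_measurable (Gamma : Type) (d : measure_display)
    (K : measurableType d) (c : Gamma) :
  measurable_fun setT (fun w : product_space Gamma K => w c).
Proof.
move=> _ A mA; rewrite setTI; apply: sub_sigma_algebra.
by exists c, A.
Qed.

(** Fixing the window means fixing a finite-dimensional box, so the window has a product law. The
    result is the sum found in [sum_colouring_injective], which is how the shift and the colourings
    are compared. *)
Lemma product_window_law (R : realType) (Gamma : choiceType)
    (e : measure_display) (K : measurableType e) (kappa : probability K R)
    (P : probability (product_space Gamma K) R)
    (W : {fset Gamma}) (I : finType) (i0 : I) (q : K -> I)
    (h : (Gamma -> I) -> R) :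
  (forall (F : {fset Gamma}) (A : Gamma -> set K),
    (forall c, measurable (A c)) ->
    P [set w | forall c, c \in F -> A c (w c)] = \prod_(c <- F) kappa (A c)) ->
  measurable_fibers q -> depends_on W h -> (forall a, 0 <= h a)%R ->
  \int[P]_w (h (q \o w))%:E =
  (\sum_(a : {ffun W -> I}) h (extend i0 a) *
      \prod_w fine (kappa (q @^-1` [set a w])))%:E.
Proof.
move=> Pprod mq hW h0.
pose Q (w : product_space Gamma K) := window W (q \o w).
have mQ : measurable_fibers Q.
  apply: measurable_fibers_ffun => w.
  exact: (measurable_fibers_precomp (@coordinate_measurable _ _ K (val w)) mq).
have -> : (fun w : product_space Gamma K => (h (q \o w))%:E) =
          (fun w => (h (extend i0 (Q w)))%:E).
  by apply/funext => w; rewrite extend_window.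
rewrite (integral_fibers P (h := fun a => h (extend i0 a)) mQ)//.
congr (_%:E); apply: eq_bigr => a _; congr (_ * _)%R.
have -> : Q @^-1` [set a] =
    [set w | forall c, c \in W -> (q @^-1` [set extend i0 a c]) (w c)].
  apply/seteqP; split=> w /= => [<- c cW|H].
    by rewrite -[c]/(val [` cW]%fset) extendE ffunE.
  apply/ffunP => c; rewrite ffunE /= (H (val c)) ?extendE//; exact: valP.
rewrite (Pprod W (fun c => q @^-1` [set extend i0 a c])); last by move=> c.
rewrite big_seq_fsetE/=.
under eq_bigr do rewrite extendE.
rewrite (_ : \prod_(w : W) _ = (\prod_(w : W) fine (kappa (q @^-1` [set a
  w])))%:E)//.
by rewrite -prodEFin; apply: eq_bigr => w _; rewrite fineK// fin_num_measure.
Qed.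

(** * Colourings along a free action *)

Section Core.
Context (R : realType) (Gamma : groupType).
Context (d : measure_display) (X : measurableType d) (mu : probability X R)
        (f : Gamma -> X -> X).
Hypotheses (actf : pmp_action mu f) (freef : free_action mu f).

(** The first [n] separating sets cut [X] into finitely many cells. If two translates of [x] share a
    cell for every [n], they are equal, which freeness excludes almost everywhere; continuity from
    above gives a good [n]. *)
Lemma separating_partition (W : {fset Gamma}) (eps : R) : (0 < eps)%R ->
  exists (J : finType) (j : X -> J), measurable_fibers j /\
    exists v : X -> {ffun W -> J}, [/\ v = fun x => [ffun w => j (f (val w) x)],
      measurable_fibers v &
      mu (v @^-1` [set u : {ffun W -> J} | ~ injective u]) <= eps%:E].
Proof.
move=> e0.
have [D [mD sepD]] := standard_borel_separation (pmp_standard actf).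
pose j n x : {ffun 'I_n -> bool} := [ffun i : 'I_n => `[< D i x >]].
have mj n : measurable_fibers (j n).
  by apply: measurable_fibers_ffun => i; exact: measurable_fibers_asbool.
pose v n x : {ffun W -> {ffun 'I_n -> bool}} := [ffun w : W => j n (f (val w)
  x)].
have mv n : measurable_fibers (v n).
  apply: measurable_fibers_ffun => w.
  exact: (measurable_fibers_precomp (pmp_measurable actf (val w)) (mj n)).
pose B n := v n @^-1` [set u : {ffun W -> {ffun 'I_n -> bool}} | ~ injective u].
have mB n : measurable (B n).
  exact: (measurable_fibers_preimage _ (mv n)).
have niB m n : (m <= n)%N -> B n `<=` B m.
  move=> mn x; apply: contra_not => inj w w'; rewrite !ffunE => jw; apply: inj.
  rewrite !ffunE; apply/ffunP => i; rewrite !ffunE.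
  by have /ffunP/(_ (widen_ord mn i)) := jw; rewrite !ffunE.
have capB : mu.-negligible (\bigcap_n B n).
  apply: negligibleS freef => x Bx /= xfree.
  have /choice [N NP] (p : W * W) : exists n, p.1 <> p.2 ->
      D n (f (val p.1) x) /\ ~ D n (f (val p.2) x).
    have [->|/eqP ww'] := eqVneq p.1 p.2; first by exists 0%N.
    have /sepD [n Dn] : f (val p.1) x <> f (val p.2) x.
      by apply: xfree => /val_inj.
    by exists n.
  (* The cells at stage [M] test the sets of index below [M], hence the successor. *)
  pose M := (\max_(p : W * W) N p).+1.
  have := Bx M I; apply => w w'; rewrite !ffunE => jww'.
  apply/eqP/negPn/negP => /eqP ww'.
  have NM : (N (w, w') < M)%N.
    by rewrite ltnS (leq_bigmax (F := N)).
  have [D1 D2] := NP (w, w') ww'.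
  have /ffunP/(_ (Ordinal NM)) := jww'; rewrite !ffunE /= => H.
  by apply: D2; apply/asboolP; rewrite /= -H; apply/asboolP.
have [N HN] := nonincreasing_measure_small e0 mB niB capB.
exists {ffun 'I_N -> bool}, (j N); split; first exact: mj.
exists (v N); split; [by []|exact: mv|exact: (HN N (leqnn N))].
Qed.

(* The colouring gives independent colours to the cells of a partition fine
   enough to separate the points [f w x], for [w] in [W] and most [x]; some
   colouring does not exceed the average. *)
Lemma free_action_colouring
    (e : measure_display) (K : measurableType e) (kappa : probability K R)
    (P : probability (product_space Gamma K) R) (I : finType) (i0 : I)
    (q : K -> I) (W : {fset Gamma}) (h : (Gamma -> I) -> R) (M eps : R) :
  is_product_measure kappa P -> measurable_fibers q -> depends_on W h ->
  (forall a, 0 <= h a <= M)%R -> (0 < eps)%R ->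
  exists2 l : X -> I, measurable_fibers l &
    \int[mu]_x (h (fun g => l (f g x)))%:E <=
    \int[P]_w (h (q \o w))%:E + eps%:E.
Proof.
move=> Pprod mq hW h0M e0.
have h0 a : (0 <= h a)%R by have /andP[] := h0M a.
have hM a : (h a <= M)%R by have /andP[] := h0M a.
have M0 : (0 <= M)%R by exact: le_trans (h0 (fun=> i0)) (hM _).
(* Points whose translates share a cell cost at most [M] each; adding 1 keeps the denominator
   positive. *)
have eM0 : (0 < eps / (M + 1))%R by rewrite divr_gt0// ltr_wpDl.
have [J [j [mj [v [vE mv mubad]]]]] := separating_partition W eM0.
pose p i := fine (kappa (q @^-1` [set i])).
have p0 i : (0 <= p i)%R by exact: fine_ge0.
have p1 : (\sum_i p i = 1)%R by exact: sum_fibers.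
pose S : R :=
  (\sum_(a : {ffun W -> I}) h (extend i0 a) * \prod_w p (a w))%R.
pose H (u : {ffun W -> J}) (c : {ffun J -> I}) : R :=
  h (extend i0 [ffun w => c (u w)]).
pose bad (u : {ffun W -> J}) : R := (~~ injectiveb u)%:R%R.
pose m (u : {ffun W -> J}) : R := fine (mu (v @^-1` [set u])).
have S0 : (0 <= S)%R by rewrite sumr_ge0// => a _; rewrite mulr_ge0// prodr_ge0.
(* With distinct cells the mean is exactly the Bernoulli value [S]; otherwise it is bounded by
   [M]. *)
have avg u : (\sum_(c : {ffun J -> I}) (\prod_k p (c k)) * H u c <= S + M *
  bad u)%R.
  have [/injectiveP uinj|ninj] := boolP (injectiveb u).
    rewrite /bad (introT (injectiveP u) uinj) mulr0 addr0.
    by rewrite (sum_colouring_injective p1 (fun a => h (extend i0 a)) uinj).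
  rewrite /bad ninj mulr1 ler_wpDl//.
  apply: (@le_trans _ _ (\sum_(c : {ffun J -> I}) (\prod_k p (c k)) * M)%R).
    by apply: ler_sum => c _; rewrite ler_wpM2l ?hM// prodr_ge0.
  by rewrite -mulr_suml sum_colouring_weight// mul1r.
have m0 u : (0 <= m u)%R by exact: fine_ge0.
have [c hc] := colouring_le_average p0 p1 i0 m0 avg.
exists (c \o j); first exact: measurable_fibers_comp.
have -> : (fun x => (h (fun g => (c \o j) (f g x)))%:E) = (fun x => (H (v x)
  c)%:E).
  apply/funext => x; rewrite /H -(extend_window i0 (fun g => (c \o j) (f g x))
    hW).
  by congr (h (extend _ _))%:E; apply/ffunP => w; rewrite !ffunE vE ffunE.
rewrite (integral_fibers mu (h := H^~ c) mv); last by move=> u; exact: h0.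
rewrite (product_window_law i0 Pprod mq hW h0) -/S -EFinD lee_fin.
apply: (le_trans hc).
under eq_bigr do rewrite mulrDl -mulrA.
rewrite big_split/= -!mulr_sumr (sum_fibers mu mv) mulr1 lerD2l.
have -> : (\sum_u bad u * m u = fine (mu (v @^-1` [set u : {ffun W -> J} | ~
  injective u])))%R.
  apply: EFin_inj; rewrite -(integral_fibers mu mv)//.
  rewrite fineK; last by rewrite fin_num_measure//; exact:
    measurable_fibers_preimage.
  rewrite (integral_bool mu (measurable_fibers_comp (fun u : {ffun W -> J} =>
    ~~ injectiveb u) mv)).
  congr (mu _); apply/seteqP; split=> x /=.
    by move=> /negP ni /injectiveP.
  by move=> ni; apply/negP => /injectiveP.
have := mubad; rewrite -[leLHS]fineK; last first.
  by rewrite fin_num_measure//; exact: measurable_fibers_preimage.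
rewrite lee_fin => mubad'.
apply: (@le_trans _ _ (M * (eps / (M + 1)))%R); first exact: ler_wpM2l.
by rewrite mulrCA ler_piMr ?(ltW e0)// ler_pdivrMr ?ltr_wpDl// mul1r lerDl.
Qed.

End Core.

(** * Local sets of a Bernoulli shift *)

(** A set decided by finitely many coordinates, each seen through a finite-valued label. The label
    type belongs to the record because a union has to pair the labels of its members. *)
Record local_set (G : choiceType) (e : measure_display) (K : measurableType e)
    := LocalSet {
  label_type : finType ;
  label0 : label_type ;
  label : K -> label_type ;
  label_measurable : measurable_fibers label ;
  local_support : {fset G} ;
  local_pred : (G -> label_type) -> bool ;
  local_pred_dep : depends_on local_support local_pred }.

Arguments label {G e K}.
Arguments label0 {G e K}.
Arguments label_measurable {G e K}.
Arguments local_support {G e K}.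
Arguments local_pred {G e K}.
Arguments local_pred_dep {G e K}.

Definition local_mem (G : choiceType) (e : measure_display)
    (K : measurableType e) (L : local_set G K) (w : G -> K) : bool :=
  local_pred L (label L \o w).

Section LocalSets.
Context (G : choiceType) (e : measure_display) (K : measurableType e).

Lemma local_setC (L : local_set G K) :
  exists L', forall w, local_mem L' w = ~~ local_mem L w.
Proof.
have dep : depends_on (local_support L) (fun a => ~~ local_pred L a).
  by move=> a b /(local_pred_dep L) ->.
by exists (LocalSet (label0 L) (label_measurable L) dep).
Qed.

Lemma local_setU (L1 L2 : local_set G K) :
  exists L, forall w, local_mem L w = local_mem L1 w || local_mem L2 w.
Proof.
pose q x := (label L1 x, label L2 x).
have mq : measurable_fibers q.
  move=> [i1 i2].
  have -> : q @^-1` [set (i1, i2)] =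
      (label L1 @^-1` [set i1]) `&` (label L2 @^-1` [set i2]).
    apply/seteqP; split=> x /=; first by move=> [<- <-].
    by move=> [<- <-].
  by apply: measurableI; exact: label_measurable.
have dep : depends_on (local_support L1 `|` local_support L2)%fset
    (fun a => local_pred L1 (fst \o a) || local_pred L2 (snd \o a)).
  move=> a b ab; congr orb; apply: local_pred_dep => g gL /=; rewrite ab//;
    by rewrite inE gL ?orbT.
by exists (LocalSet (label0 L1, label0 L2) mq dep).
Qed.

Lemma local_cylinder (c : G) (A : set K) : measurable A ->
  exists L : local_set G K, forall w, local_mem L w <-> A (w c).
Proof.
move=> mA.
have dep : depends_on [fset c]%fset (fun a : G -> bool => a c).
  by move=> a b; apply; rewrite inE.
exists (LocalSet false (measurable_fibers_asbool mA) dep) => w.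
by rewrite /local_mem /=; split=> [/asboolP|?]//; apply/asboolP.
Qed.

Context (R : realType) (P : probability (product_space G K) R) (V : finType)
        (s : V -> product_space G K -> product_space G K).
Hypothesis ms : forall v, measurable_fun setT (s v).

(** The exceptional set is to be small under every [s v] at once, since a pattern reads the set at
    several translates. *)
Definition locally_approximable (C : set (product_space G K)) : Prop :=
  forall eps : R, (0 < eps)%R -> exists (L : local_set G K) E,
    [/\ measurable E, forall v, P (s v @^-1` E) <= eps%:E &
        forall w, ~ E w -> (C w <-> local_mem L w)].

Let measurable_preimage v E : measurable E -> measurable (s v @^-1` E).
Proof. by move=> mE; rewrite -[X in measurable X]setTI; exact: ms. Qed.

Lemma locally_approximableC C :
  locally_approximable C -> locally_approximable (~` C).
Proof.
move=> aC eps /aC [L [E [mE PE CL]]]; have [L' L'E] := local_setC L.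
exists L', E; split=> // w /CL CLw /=; rewrite L'E CLw.
by split=> [/negP|/negP].
Qed.

Lemma locally_approximableU C D : locally_approximable C ->
  locally_approximable D -> locally_approximable (C `|` D).
Proof.
move=> aC aD eps e0; have e20 : (0 < eps / 2)%R by rewrite divr_gt0.
have [L1 [E1 [mE1 PE1 CL1]]] := aC _ e20.
have [L2 [E2 [mE2 PE2 CL2]]] := aD _ e20.
have [L LE] := local_setU L1 L2.
exists L, (E1 `|` E2); split=> [|v|w]; first exact: measurableU.
  rewrite preimage_setU (splitr eps) EFinD.
  apply: le_trans (leeD (PE1 v) (PE2 v)).
  by apply: measureU2; exact: measurable_preimage.
move=> /not_orP[/CL1 H1 /CL2 H2]; rewrite LE /setU /= H1 H2.
by split=> /orP.
Qed.

Lemma locally_approximable0 : locally_approximable set0.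
Proof.
have dep : depends_on fset0 (fun _ : G -> bool => false) by [].
move=> eps e0.
exists (LocalSet false (measurable_fibers_asbool measurable0) dep), set0.
by split=> [//|v|w _]; [rewrite preimage_set0 measure0 lee_fin ltW|split].
Qed.

(** The part [F n] missed by the partial union [D n] decreases to the empty set, hence is eventually
    small under each of the finitely many [s v]. *)
Lemma locally_approximable_bigcup (C : nat -> set (product_space G K)) :
  (forall n, measurable (C n)) -> (forall n, locally_approximable (C n)) ->
  locally_approximable (\bigcup_n C n).
Proof.
move=> mC aC eps e0; have e20 : (0 < eps / 2)%R by rewrite divr_gt0.
pose D n := \big[setU/set0]_(i < n) C i.
have mD n : measurable (D n) by exact: bigsetU_measurable.
have aD n : locally_approximable (D n).
  elim: n => [|n IHn]; first by rewrite /D big_ord0; exact: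
    locally_approximable0.
  by rewrite /D big_ord_recr /=; exact: locally_approximableU.
pose F n := \bigcup_n C n `\` D n.
have mF n : measurable (F n).
  by apply: measurableD => //; exact: bigcup_measurable.
have /choice [N HN] (v : V) : exists N, forall n, (N <= n)%N ->
    P (s v @^-1` F n) <= (eps / 2)%:E.
  apply: nonincreasing_measure_small => // [n|m n mn w|].
  - exact: measurable_preimage.
  - move=> [Cw nD]; split=> //; apply: contra_not nD.
    rewrite /D -!bigcup_mkord => -[i /= im Ci]; exists i => //=.
    exact: leq_trans im mn.
  rewrite (_ : \bigcap_n _ = set0); first exact: negligible_set0.
  rewrite -subset0 => w Fw; have [[n _ Cn] _] := Fw 0%N I.
  have [_] := Fw n.+1 I; apply; rewrite /D -bigcup_mkord.
  by exists n => //=.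
pose M := (\max_v N v)%N.
have [L [E [mE PE CL]]] := aD M _ e20.
exists L, (F M `|` E); split=> [|v|w]; first exact: measurableU.
  rewrite preimage_setU (splitr eps) EFinD.
  apply: (@le_trans _ _ (P (s v @^-1` F M) + P (s v @^-1` E))).
    by apply: measureU2; exact: measurable_preimage.
  by apply: leeD => //; apply: HN; exact: leq_bigmax.
move=> /not_orP[nF /CL <-]; split=> [Cw|]; first by apply: contrapT => nD;
  exact: nF.
by rewrite /D -bigcup_mkord => -[i _ Ci]; exists i.
Qed.

(** The measurable approximable sets form a sigma-algebra, and cylinders are local themselves. *)
Lemma measurable_locally_approximable (C : set (product_space G K)) :
  measurable C -> locally_approximable C.
Proof.
move=> mC.
suff: [set C | measurable C /\ locally_approximable C] C by case.
move: C mC; apply: smallest_sub; last first.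
  move=> C CC; split; first exact: sub_sigma_algebra.
  move: CC => [c [A [mA ->]]] eps e0.
  have [L LE] := local_cylinder c mA.
  exists L, set0; split=> [//|v|w _]; first by rewrite preimage_set0 measure0
    lee_fin ltW.
  by rewrite LE.
split=> [|C [mC aC]|C mC].
- by split=> //; exact: locally_approximable0.
- rewrite setTD; split; first exact: measurableC.
  exact: locally_approximableC.
split; first by apply: bigcupT_measurable => n; case: (mC n).
by apply: locally_approximable_bigcup => n; case: (mC n).
Qed.

End LocalSets.

(** * Patterns and graphings *)

(** Closing [S] repeatedly under [u v^-1] exhausts the group by finite sets; an element is coded by
    stage and position. Codes are shifted by one to put 1 at index 0, where patterns have their base
    point. *)
Lemma finitely_generated_enumeration (Gamma : groupType) :
  finitely_generated Gamma ->
  exists2 e : nat -> Gamma, e 0%N = 1%g & forall g, exists n, e n = g.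
Proof.
move=> [S genS].
pose fix H n : {fset Gamma} := if n is m.+1 then
  (H m `|` [fset (u * v^-1)%g | u in H m, v in H m])%fset else (1%g |` S)%fset.
have HS m n : (m <= n)%N -> {subset H m <= H n}.
  move=> /subnK <-; elim: (n - m)%N => [//|k IHk] x /IHk xH /=.
  by rewrite inE xH.
have Hall g : exists n, g \in H n.
  have := genS (fun g => `[< exists n, g \in H n >]).
  move=> /(_ _ _ g) => H0; apply/asboolP; apply: H0.
    split; first by apply/asboolP; exists 0%N; rewrite !inE eqxx.
    move=> u v /asboolP[m um] /asboolP[n vn]; apply/asboolP.
    exists (maxn m n).+1; rewrite /= inE; apply/orP; right.
    apply/imfset2P; exists u; first by apply: HS um; exact: leq_maxl.
    by exists v => //; apply: HS vn; exact: leq_maxr.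
  by move=> x xS; apply/asboolP; exists 0%N; rewrite !inE xS orbT.
exists (fun k => if k is k'.+1 then
    let p := odflt (0%N, 0%N) (choice.unpickle k') in nth 1%g (H p.1) p.2
  else 1%g) => // g.
have [n gn] := Hall g.
exists (choice.pickle (n, index g (H n))).+1.
by rewrite choice.pickleK /= nth_index.
Qed.

(** * Generated equivalence relations *)

Section Connected.
Context (T : Type).
Implicit Types E : T -> T -> Prop.

(** In this impredicative form, induction along a path is application to a suitable [Q]. *)
Definition connected_by E (a b : T) : Prop :=
  forall Q, Equivalence Q -> (forall x y, E x y -> Q x y) -> Q a b.

Lemma connected_by_equiv E : Equivalence (connected_by E).
Proof.
split=> [x Q QE _|x y xy Q QE EQ|x y z xy yz Q QE EQ]; first by reflexivity.
  by symmetry; exact: xy.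
by transitivity y; [exact: xy|exact: yz].
Qed.

Lemma connected_by_sub E x y : E x y -> connected_by E x y.
Proof. by move=> Exy Q _; exact. Qed.

Lemma connected_by_mono E E' x y : (forall a b, E a b -> E' a b) ->
  connected_by E x y -> connected_by E' x y.
Proof. by move=> EE' Exy Q QE E'Q; apply: Exy => // a b /EE' /E'Q. Qed.

(** A path has finitely many edges, so it lies in one stage: being joined at some stage is already
    an equivalence relation, transitive by monotonicity. *)
Lemma connected_by_directed (E : nat -> T -> T -> Prop) x y :
  (forall m n a b, (m <= n)%N -> E m a b -> E n a b) ->
  connected_by (fun a b => exists n, E n a b) x y ->
  exists n, connected_by (E n) x y.
Proof.
move=> Emono Exy.
have mono m n a b : (m <= n)%N -> connected_by (E m) a b -> connected_by (E n)
  a b.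
  by move=> mn; apply: connected_by_mono => ? ?; exact: Emono.
apply: (Exy (fun a b => exists n, connected_by (E n) a b)); last first.
  by move=> a b [n Eab]; exists n; exact: connected_by_sub.
split=> [a|a b [n ab]|a b c [m ab] [n bc]].
- by exists 0%N; have := connected_by_equiv (E 0%N) => -[].
- by exists n; have := connected_by_equiv (E n) => -[_ + _]; apply.
exists (maxn m n); have := connected_by_equiv (E (maxn m n)) => -[_ _]; apply.
  exact: mono (leq_maxl _ _) ab.
exact: mono (leq_maxr _ _) bc.
Qed.

End Connected.

Section GeneratedRel.
Context (X : Type) (Phi : graphing_data X).

Lemma generated_rel_equiv :
  Equivalence (fun x y => generated_rel Phi (x, y)).
Proof.
split=> [x E [[+ _ _] _]|x y xy E ES|x y z xy yz E ES]; first by apply.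
  by have [[_ + _] _] := ES; apply; exact: (xy E ES).
by have [[_ _ +] _] := ES; apply; [exact: (xy E ES)|exact: (yz E ES)].
Qed.

Lemma generated_rel_sub : graphing_pairs Phi `<=` generated_rel Phi.
Proof. exact: sub_smallest. Qed.

End GeneratedRel.

(* A pattern records, for [v] and [t = (i, k)], whether the [i]-th set of edges
   labelled [e k] starts at the point [e v] of the orbit; [edge] is the
   corresponding finite graph on the group. *)
Section Patterns.
Context (R : realType) (Gamma : groupType) (e : nat -> Gamma)
        (S : {fset Gamma}).

Definition pattern (n : nat) : finType :=
  {ffun 'I_n.+1 * ('I_n.+1 * 'I_n.+1) -> bool}.

Definition edge n (b : pattern n) (p q : Gamma) : Prop :=
  exists v t, [/\ b (v, t), p = e v & q = (e t.2 * e v)%g].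

Definition joins n (b : pattern n) (s : Gamma) : bool :=
  `[< connected_by (edge b) 1%g s >].

(** Edges are counted where they start, hence only at [ord0], the index of the base point. The
    second sum pays for the edge to each generator that the pattern fails to reach. *)
Definition pattern_cost n (b : pattern n) : R :=
  (\sum_(t : 'I_n.+1 * 'I_n.+1) (b (ord0, t))%:R +
   \sum_(s : S) (~~ joins b (val s))%:R)%R.

Definition pattern_bound n : R :=
  (\sum_(t : 'I_n.+1 * 'I_n.+1) 1 + \sum_(s : S) 1)%R.

Lemma pattern_cost_bound n (b : pattern n) :
  (0 <= pattern_cost b <= pattern_bound n)%R.
Proof.
rewrite addr_ge0 ?sumr_ge0//=; apply: lerD; apply: ler_sum => i _;
by rewrite lern1 leq_b1.
Qed.

Lemma integral_pattern_cost (d : measure_display) (X : measurableType d)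
    (mu : probability X R) n (q : X -> pattern n) : measurable_fibers q ->
  \int[mu]_x (pattern_cost (q x))%:E =
  \sum_(t : 'I_n.+1 * 'I_n.+1) mu [set x | q x (ord0, t)] +
  \sum_(s : S) mu [set x | ~~ joins (q x) (val s)].
Proof.
move=> mq.
have mE (h : pattern n -> R) : measurable_fun setT (fun x => (h (q x))%:E).
  exact: (measurable_fun_fibers (fun b => (h b)%:E) mq).
under eq_integral do rewrite EFinD -!sumEFin.
rewrite ge0_integralD//; first last.
- apply: emeasurable_sum => s; exact: (mE (fun b => (~~ joins b (val s))%:R%R)).
- by move=> x _; apply: sume_ge0.
- apply: emeasurable_sum => t; exact: (mE (fun b => (b (ord0, t))%:R%R)).
- by move=> x _; apply: sume_ge0.
congr (_ + _); rewrite ge0_integral_sum//.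
- apply: eq_bigr => t _; rewrite integral_bool//.
  exact: (measurable_fibers_comp (fun b : pattern n => b (ord0, t)) mq).
- by move=> t; exact: (mE (fun b => (b (ord0, t))%:R%R)).
- apply: eq_bigr => s _; rewrite integral_bool//.
  exact: (measurable_fibers_comp (fun b : pattern n => ~~ joins b (val s)) mq).
- by move=> s; exact: (mE (fun b => (~~ joins b (val s))%:R%R)).
Qed.

Definition orbit_pattern n (X : Type) (f : Gamma -> X -> X)
    (B : 'I_n.+1 * 'I_n.+1 -> set X) (x : X) : pattern n :=
  [ffun vt : 'I_n.+1 * ('I_n.+1 * 'I_n.+1) => `[< B vt.2 (f (e vt.1) x) >]].

Lemma orbit_pattern_measurable n (d : measure_display) (X : measurableType d)
    (f : Gamma -> X -> X) (B : 'I_n.+1 * 'I_n.+1 -> set X) :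
  (forall g, measurable_fun setT (f g)) -> (forall t, measurable (B t)) ->
  measurable_fibers (orbit_pattern f B).
Proof.
move=> mf mB; apply: measurable_fibers_ffun => -[v t] /=.
exact: (measurable_fibers_precomp (mf (e v)) (measurable_fibers_asbool (mB t))).
Qed.

End Patterns.

(** * Upper bounds for the cost of an action *)

Section Action.
Context (R : realType) (Gamma : groupType).
Context (d : measure_display) (X : measurableType d) (mu : probability X R)
        (f : Gamma -> X -> X).
Hypothesis actf : pmp_action mu f.

Lemma pmp_actK g : cancel (f g) (f g^-1%g).
Proof. by move=> x; rewrite -(pmp_mul actf) mulVg (pmp_one actf). Qed.

Lemma pmp_actKV g : cancel (f g^-1%g) (f g).
Proof. by move=> x; rewrite -(pmp_mul actf) mulgV (pmp_one actf). Qed.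

Lemma pmp_image g (C : set X) : f g @` C = f g^-1%g @^-1` C.
Proof.
apply/seteqP; split=> x /=; first by move=> [y Cy <-]; rewrite pmp_actK.
by move=> Cx; exists (f g^-1%g x) => //; exact: pmp_actKV.
Qed.

Lemma pmp_measurable_preimage g (C : set X) :
  measurable C -> measurable (f g @^-1` C).
Proof.
by move=> mC; rewrite -[X in measurable X]setTI; exact: (pmp_measurable actf).
Qed.

Lemma pmp_partial_bijection g (A : set X) : measurable A ->
  partial_mp_bijection mu A (f g @` A) (f g).
Proof.
move=> mA; split=> //.
- by rewrite pmp_image; exact: pmp_measurable_preimage.
- split; [by move=> x Ax; exists x| |by move=> y [x Ax <-]; exists x].
  by move=> x y _ _; exact: (can_inj (pmp_actK g)).
- exact: measurable_funTS (pmp_measurable actf g).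
- by move=> C mC _; rewrite pmp_image; exact: pmp_measurable_preimage.
- by move=> C mC _; rewrite pmp_image (pmp_preserving actf).
Qed.

Lemma orbit_rel_equiv : Equivalence (fun x y => orbit_rel f (x, y)).
Proof.
split=> [x|x y [g /= ->]|x y z [g /= ->] [h /= ->]].
- by exists 1%g; rewrite (pmp_one actf).
- by exists g^-1%g; rewrite /= pmp_actK.
by exists (h * g)%g; rewrite /= (pmp_mul actf).
Qed.

Lemma generated_rel_orbit (Phi : graphing_data X) :
  graphing_pairs Phi `<=` orbit_rel f -> generated_rel Phi `<=` orbit_rel f.
Proof. by move=> sub xy; apply; split => //; exact: orbit_rel_equiv. Qed.

(** The group elements that move every point within its class form a subgroup containing [S]. *)
Lemma generates_of_generators (S : {fset Gamma}) (Phi : graphing_data X) :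
  (forall H : {pred Gamma}, group_closed H -> {subset S <= H} ->
     forall x, x \in H) ->
  graphing_pairs Phi `<=` orbit_rel f ->
  (forall x s, s \in S -> generated_rel Phi (x, f s x)) ->
  generates mu f Phi.
Proof.
move=> genS sub hS.
have [grefl gsym gtrans] := generated_rel_equiv Phi.
have all_g g x : generated_rel Phi (x, f g x).
  suff : g \in (fun g => `[< forall x, generated_rel Phi (x, f g x) >]).
    by move=> /asboolP.
  apply: genS => [|s sS]; last by apply/asboolP => y; exact: hS.
  split=> [|u v /asboolP hu /asboolP hv]; apply/asboolP => y.
    by rewrite (pmp_one actf); exact: grefl.
  rewrite (pmp_mul actf); apply: gtrans (hu _).
  by apply: gsym; rewrite -{2}(pmp_actKV v y).
apply: aeW => x y; split; last exact: generated_rel_orbit.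
by move=> [g /= ->].
Qed.

Lemma cost_le_finite_graphing (S : {fset Gamma}) (T : finType)
    (D : T -> set X) (a : T -> Gamma) :
  (forall H : {pred Gamma}, group_closed H -> {subset S <= H} ->
     forall x, x \in H) ->
  (forall t, measurable (D t)) ->
  (forall x s, s \in S -> connected_by
     (fun y z => exists t, D t y /\ z = f (a t) y) x (f s x)) ->
  cost mu f <= \sum_t mu (D t).
Proof.
move=> genS mD hS.
(* [None], the default beyond the end of the list, stands for the empty partial map. *)
pose l := map Some (enum T).
pose Phi := GraphingData
  (fun k => if nth None l k is Some t then D t else set0)
  (fun k => if nth None l k is Some t then f (a t) @` D t else set0)
  (fun k => if nth None l k is Some t then f (a t) else id).
have sub : graphing_pairs Phi `<=` orbit_rel f.
  move=> [x y] [k /= []]; case: (nth None l k) => [t|//] _ ->.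
  by exists (a t).
apply: ereal_inf_lbound; exists Phi.
  split; first split=> // k /=.
    case: (nth None l k) => [t|]; first exact: pmp_partial_bijection.
    split=> //.
    - by split=> //; move=> y [].
    - by move=> C mC C0; rewrite image_id.
    - by move=> C mC C0; rewrite image_id.
  apply: generates_of_generators genS sub _ => x s sS.
  apply: (hS x s sS (fun y z => generated_rel Phi (y, z))).
    exact: generated_rel_equiv.
  move=> y z [t [Dy ->]]; apply: generated_rel_sub.
  exists (enum_rank t) => /=.
  have -> : nth None l (enum_rank t) = Some t.
    by rewrite (nth_map t) ?nth_enum_rank// -cardE.
  by [].
rewrite /graphing_cost (nneseries_split 0 (size l))//= add0n eseries0; last
  first.
  by move=> k lk _; rewrite nth_default.
rewrite adde0 -(big_nth None xpredT
  (fun o => mu (if o is Some t then D t else set0))) big_map big_enum/=.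
by [].
Qed.

(** The graphing consists of the edges given by [B] and, for each generator [s], the edges from [x]
    to [f s x] on the set [Z s] where the pattern does not join 1 to [s]. *)
Lemma cost_le_pattern_cost (S : {fset Gamma}) (e : nat -> Gamma) n
    (B : 'I_n.+1 * 'I_n.+1 -> set X) :
  (forall H : {pred Gamma}, group_closed H -> {subset S <= H} ->
     forall x, x \in H) ->
  e 0%N = 1%g -> (forall t, measurable (B t)) ->
  cost mu f <= \int[mu]_x (pattern_cost R e S (orbit_pattern e f B x))%:E.
Proof.
move=> genS e0 mB.
have mq := orbit_pattern_measurable e (pmp_measurable actf) mB.
rewrite integral_pattern_cost//.
pose Z (s : S) := [set x | ~~ joins e (orbit_pattern e f B x) (val s)].
have mZ s : measurable (Z s).
  exact: (measurable_fibers_preimage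
    [set b : pattern n | ~~ joins e b (val s)] mq).
have BE t : [set x | orbit_pattern e f B x (ord0, t)] = B t.
  by apply/seteqP; split=> x /=; rewrite ffunE/= e0 (pmp_one actf) => /asboolP.
pose D (t : 'I_n.+1 * 'I_n.+1 + S) := match t with inl t => B t | inr s => Z s
  end.
pose a (t : 'I_n.+1 * 'I_n.+1 + S) :=
  match t with inl t => e t.2 | inr s => val s end.
have -> : \sum_t mu [set x | orbit_pattern e f B x (ord0, t)] +
    \sum_(s : S) mu [set x | ~~ joins e (orbit_pattern e f B x) (val s)] =
    \sum_t mu (D t).
  rewrite big_sumType/=; congr (_ + _).
  by apply: eq_bigr => t _; rewrite BE.
apply: (cost_le_finite_graphing (a := a) genS) => [[t|s]|x s sS]; [exact:
  mB|exact: mZ|].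
have [/asboolP js|njs] := boolP (joins e (orbit_pattern e f B x) s); last first.
  by apply: connected_by_sub; exists (inr [` sS]%fset).
set E := (fun y z => _).
have [Erefl Esym Etrans] := connected_by_equiv E.
rewrite -{1}(pmp_one actf x).
(* A path from 1 to [s] in the group is pushed to the orbit of [x], sending [p] to [f p x]. *)
apply: (js (fun p q => connected_by E (f p x) (f q x))).
  split=> [p|p q|p q r]; [exact: Erefl|exact: Esym|exact: Etrans].
move=> p q [v [t [+ -> ->]]]; rewrite ffunE/= => /asboolP Bt.
by apply: connected_by_sub; exists (inl t); split; rewrite //= (pmp_mul actf).
Qed.

End Action.

(** * Patterns of a generating graphing *)

Section GraphingPatterns.
Context (R : realType) (Gamma : groupType) (e : nat -> Gamma)
        (S : {fset Gamma}).
Context (d : measure_display) (Y : measurableType d) (nu : probability Y R)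
        (g : Gamma -> Y -> Y) (Phi : graphing_data Y).
Hypotheses (e0 : e 0%N = 1%g) (esurj : forall a, exists n, e n = a).
Hypotheses (actg : pmp_action nu g) (graphPhi : is_graphing nu g Phi).

(** Each edge is labelled by the least possible index [k]. This makes the pieces of a domain
    disjoint even if [e] repeats elements, so that cutting up does not raise the cost. *)
Definition edge_set (i k : nat) : set Y :=
  seqDU (fun k => [set y | gdom Phi i y /\ gmap Phi i y = g (e k) y]) k.

Let coincide i a := [set y | gdom Phi i y /\ gmap Phi i y = g a y].

(** The two maps differ at [y] exactly when some [D n] contains the image under the first but not
    under the second. *)
Let measurable_coincide i a : measurable (coincide i a).
Proof.
have [D [mD sepD]] := standard_borel_separation (pmp_standard actg).
have [pmb _] := graphPhi.
have mA := pmb_dom (pmb i).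
have -> : coincide i a = gdom Phi i `\` \bigcup_n
    ((gdom Phi i `&` gmap Phi i @^-1` D n) `\` g a @^-1` D n).
  apply/seteqP; split=> [y [Ay eq_y]|y [Ay nD]].
    by split=> // -[n _ [[_ /=]]]; rewrite eq_y.
  split=> //; apply: contrapT => /sepD [n [D1 D2]].
  by apply: nD; exists n.
apply: measurableD => //; apply: bigcup_measurable => n _.
apply: measurableD; last exact: (pmp_measurable_preimage actg).
exact: (pmb_measurable (pmb i)).
Qed.

Lemma edge_set_measurable i k : measurable (edge_set i k).
Proof.
apply: measurableD; first exact: measurable_coincide.
by apply: bigsetU_measurable => l _; exact: measurable_coincide.
Qed.

Lemma edge_set_cover i y : gdom Phi i y ->
  exists2 k, edge_set i k y & gmap Phi i y = g (e k) y.
Proof.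
move=> Ay; have [_ sub] := graphPhi.
have [a /= ya] : orbit_rel g (y, gmap Phi i y) by apply: sub; exists i.
have [k ek] := esurj a.
have : (\bigcup_k coincide i (e k)) y by exists k => //; split=> //; rewrite ek.
rewrite (seqDU_bigcup_eq (fun k => coincide i (e k))) => -[l _ yl].
by exists l => //; case: yl => -[].
Qed.

Lemma sum_edge_set i n : \sum_(k < n) nu (edge_set i k) <= nu (gdom Phi i).
Proof.
have mU : measurable (\big[setU/set0]_(k < n) edge_set i k).
  by apply: bigsetU_measurable => k _; exact: edge_set_measurable.
rewrite -measure_semi_additive_ord_I//.
- apply: le_measure; rewrite ?inE//.
    by have [pmb _] := graphPhi; exact: pmb_dom (pmb i).
  by rewrite -bigcup_mkord => y [k _ [[]]].
- by move=> k _; exact: edge_set_measurable.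
- exact: (sub_trivIset (subsetT _) (@trivIset_seqDU _ _)).
Qed.

Definition edge_pattern n : Y -> pattern n :=
  orbit_pattern e g (fun t : 'I_n.+1 * 'I_n.+1 => edge_set t.1 t.2).

Lemma edge_mono m n y p q : (m <= n)%N ->
  edge e (edge_pattern m y) p q -> edge e (edge_pattern n y) p q.
Proof.
move=> mn [v [[i k] []]]; rewrite ffunE/= => B -> ->.
have mn1 : (m.+1 <= n.+1)%N by [].
exists (widen_ord mn1 v), (widen_ord mn1 i, widen_ord mn1 k).
by split=> //; rewrite ffunE.
Qed.

(* The orbit of [y] is a copy of the group, so the equivalence relation
   generated by the graphing lifts to the group. *)
Lemma generated_joins y s :
  (forall a b, a <> b -> g a y <> g b y) ->
  generated_rel Phi (y, g s y) ->
  exists n, joins e (edge_pattern n y) s.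
Proof.
move=> freey gen.
pose E n := edge e (edge_pattern n y).
pose conn := connected_by (fun p q => exists n, E n p q).
suff : conn 1%g s.
  move=> js; have [|n En] := connected_by_directed _ js.
    by move=> m n p q; exact: edge_mono.
  by exists n; apply/asboolP.
have ginj a b : g a y = g b y -> a = b.
  by move=> gab; apply: contrapT => /freey.
have [crefl csym ctrans] : Equivalence conn by exact: connected_by_equiv.
have step i p : gdom Phi i (g p y) -> exists2 k,
    gmap Phi i (g p y) = g (e k) (g p y) & conn p (e k * p)%g.
  move=> /edge_set_cover [k Bk eqk]; exists k => //.
  apply: connected_by_sub; have [v ev] := esurj p.
  (* The edge is visible as soon as the pattern includes its position, its family and its label. *)
  pose n := maxn v (maxn i k).
  have vn : (v < n.+1)%N by rewrite ltnS leq_maxl.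
  have jn : (i < n.+1)%N by rewrite ltnS !leq_max leqnn orbT.
  have kn : (k < n.+1)%N by rewrite ltnS !leq_max leqnn !orbT.
  exists n, (Ordinal vn), (Ordinal jn, Ordinal kn).
  by rewrite /= ev; split=> //; rewrite ffunE/= ev; apply/asboolP.
(* Every group element over one point is joined to one over the other. Points off the orbit of [y]
   have none over them; asking both directions yields an equivalence relation on all of [Y]. *)
pose lift z z' := (forall p, z = g p y -> exists2 q, z' = g q y & conn p q) /\
                  (forall q, z' = g q y -> exists2 p, z = g p y & conn p q).
have lift_equiv : Equivalence lift.
  split=> [z|z z' [H1 H2]|z1 z2 z3 [H1 H2] [H3 H4]].
  - by split=> p zp; exists p => //; exact: crefl.
  - split=> p /[dup] zp; [move=> /H2|move=> /H1] => -[q zq cpq];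
      by exists q => //; exact: csym.
  - split=> p; [move=> /H1|move=> /H4] => -[q].
      by move=> /H3 [r zr qr] pq; exists r => //; exact: ctrans qr.
    by move=> /H2 [r zr qr] pq; exists r => //; exact: ctrans pq.
have [_ sub] := graphPhi.
have lift_sub : graphing_pairs Phi `<=` [set zz | lift zz.1 zz.2].
  move=> [z z'] [i /= [Az ->]]; split=> [p zp|q].
    move: Az; rewrite zp => /step [k -> cpk]; exists (e k * p)%g => //.
    by rewrite (pmp_mul actg).
  have [k _ eqk] := edge_set_cover Az; rewrite eqk => zq.
  pose p := ((e k)^-1 * q)%g.
  have zp : z = g p y by rewrite (pmp_mul actg) -zq (pmp_actK actg).
  have Ap : gdom Phi i (g p y) by rewrite -zp.
  have [l eql cpl] := step _ _ Ap; exists p => //.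
  (* The label [l] is not known to be [k], but freeness identifies the endpoints. *)
  suff <- : (e l * p)%g = q by [].
  by apply: ginj; rewrite (pmp_mul actg) -eql -zp eqk.
have [/(_ 1%g)] : lift y (g s y) by exact: gen _ (conj lift_equiv lift_sub).
by rewrite (pmp_one actg) => -[//|q /ginj <- ].
Qed.

Hypotheses (freeg : free_action nu g) (genPhi : generates nu g Phi).

Lemma edge_pattern_measurable n : measurable_fibers (@edge_pattern n).
Proof.
apply: orbit_pattern_measurable; first exact: (pmp_measurable actg).
by move=> t; exact: edge_set_measurable.
Qed.

(** Almost every [y] has a free orbit on which the graphing generates, so 1 is joined to [s] at some
    stage; the sets where this has not yet happened decrease to a null set. *)
Lemma not_joins_small (eps : R) : (0 < eps)%R ->
  exists n, forall s : S, nu [set y | ~~ joins e (edge_pattern n y) (val s)]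
    <= eps%:E.
Proof.
move=> eps0.
have /choice [N HN] (s : S) : exists N, forall n, (N <= n)%N ->
    nu [set y | ~~ joins e (edge_pattern n y) (val s)] <= eps%:E.
  apply: nonincreasing_measure_small => // [n|m n mn y /=|].
  - exact: (measurable_fibers_preimage
      [set b : pattern n | ~~ joins e b (val s)] (@edge_pattern_measurable n)).
  - apply: contra => /asboolP js; apply/asboolP.
    by apply: connected_by_mono js => p q; exact: edge_mono.
  apply: negligibleS (negligibleU freeg genPhi) => y Z.
  apply: contrapT => /not_orP[/contrapT freey /contrapT geny].
  have [|n jn] := @generated_joins y (val s) freey.
    by apply/geny; exists (val s).
  by have := Z n I; rewrite /= jn.
exists (\max_s N s)%N => s; apply: HN; exact: leq_bigmax.
Qed.

(** Truncating the graphing only lowers its cost, and for large [n] the added edges cost little. *)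
Lemma edge_pattern_cost (eps : R) : (0 < eps)%R ->
  exists n, \int[nu]_y (pattern_cost R e S (edge_pattern n y))%:E <=
            graphing_cost nu Phi + eps%:E.
Proof.
move=> eps0.
(* The successor covers the case of an empty [S]. *)
have eS0 : (0 < eps / (#|{: S}|.+1)%:R)%R by rewrite divr_gt0.
have [n Zn] := not_joins_small eS0; exists n.
rewrite integral_pattern_cost; last exact: edge_pattern_measurable.
apply: leeD.
  apply: (@le_trans _ _ (\sum_(i < n.+1) nu (gdom Phi i))).
    rewrite (eq_bigr (fun t : 'I_n.+1 * 'I_n.+1 => nu (edge_set t.1 t.2))).
      rewrite -(pair_bigA _ (fun i k : 'I_n.+1 => nu (edge_set i k)))/=.
      by apply: lee_sum => i _; exact: sum_edge_set.
    move=> t _; congr (nu _).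
    by apply/seteqP; split=> y /=; rewrite ffunE/= e0 (pmp_one actg) =>
      /asboolP.
  rewrite -(big_mkord xpredT (fun i => nu (gdom Phi i))).
  exact: nneseries_lim_ge.
apply: (@le_trans _ _ (\sum_(s : S) (eps / (#|{: S}|.+1)%:R)%:E)).
  by apply: lee_sum => s _; exact: Zn.
rewrite sumEFin lee_fin sumr_const -[leLHS]mulr_natr -mulrA ler_piMr ?ltW//.
by rewrite mulrC ltr_pdivrMr// mul1r ltr_nat.
Qed.

End GraphingPatterns.

(** * Transfer from factors of Bernoulli shifts *)

Lemma bernoulli_shift_measurable (Gamma : groupType) (d : measure_display)
    (K : measurableType d) (a : Gamma) :
  measurable_fun setT
    (@bernoulli_shift Gamma K a : product_space Gamma K -> product_space Gamma
      K).
Proof.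
apply: (@measurability _ _ (product_space Gamma K) (product_space Gamma K)
  setT (@bernoulli_shift Gamma K a) (@cylinders Gamma _ K) erefl).
move=> _ [_ [c [A [mA ->]]] <-]; rewrite setTI.
by apply: sub_sigma_algebra; exists (c * a)%g, A.
Qed.

Lemma measure_bigsetU_le (R : realType) (d : measure_display)
    (X : measurableType d) (mu : probability X R) (T : Type) (r : seq T)
    (F : T -> set X) :
  (forall t, measurable (F t)) ->
  mu (\big[setU/set0]_(t <- r) F t) <= \sum_(t <- r) mu (F t).
Proof.
move=> mF; elim: r => [|t r IHr]; first by rewrite !big_nil measure0.
rewrite !big_cons; apply: le_trans (leeD2l _ IHr).
by apply: measureU2 => //; exact: bigsetU_measurable.
Qed.

Lemma integral_factor (R : realType) (d e : measure_display)
    (X : measurableType d) (Y : measurableType e) (mu : probability X R)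
    (nu : probability Y R) (phi : X -> Y) (I : finType) (q : Y -> I)
    (h : I -> R) :
  measurable_fun setT phi ->
  (forall B, measurable B -> mu (phi @^-1` B) = nu B) ->
  measurable_fibers q -> (forall i, 0 <= h i)%R ->
  \int[mu]_x (h (q (phi x)))%:E = \int[nu]_y (h (q y))%:E.
Proof.
move=> mphi phimu mq h0.
rewrite (integral_fibers mu (measurable_fibers_precomp mphi mq) h0).
rewrite (integral_fibers nu mq h0); congr (_%:E).
by apply: eq_bigr => i _; rewrite -phimu.
Qed.

Lemma integral_le_off_small (R : realType) (d : measure_display)
    (X : measurableType d) (mu : probability X R) (I : finType)
    (q1 q2 : X -> I) (h : I -> R) (M delta : R) (E : set X) :
  measurable_fibers q1 -> measurable_fibers q2 -> measurable E ->
  (forall i, 0 <= h i <= M)%R -> (0 <= M)%R -> mu E <= delta%:E ->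
  (forall x, ~ E x -> q1 x = q2 x) ->
  \int[mu]_x (h (q1 x))%:E <= \int[mu]_x (h (q2 x))%:E + (M * delta)%:E.
Proof.
move=> mq1 mq2 mE hM M0 muE q12.
have h0 i : (0 <= h i)%R by case/andP: (hM i).
pose b x := `[< E x >].
have mb : measurable_fibers b by exact: measurable_fibers_asbool.
have m1 : measurable_fun setT (fun x => (h (q1 x))%:E).
  exact: (measurable_fun_fibers (fun i => (h i)%:E) mq1).
have m2 : measurable_fun setT (fun x => (h (q2 x))%:E).
  exact: (measurable_fun_fibers (fun i => (h i)%:E) mq2).
have m3 : measurable_fun setT (fun x => ((b x)%:R : R)%:E).
  exact: (measurable_fun_fibers (fun c : bool => (c%:R : R)%:E) mb).
apply: (@le_trans _ _ (\int[mu]_x ((h (q2 x))%:E + M%:E * ((b x)%:R)%:E))).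
  apply: ge0_le_integral => //.
  - by move=> x _; rewrite lee_fin.
  - by apply: emeasurable_funD => //; exact: measurable_funeM.
  move=> x _; rewrite -EFinM -EFinD lee_fin /b.
  case: asboolP => [_|/q12 ->]; last by rewrite mulr0 addr0.
  by rewrite mulr1 ler_wpDl//; case/andP: (hM (q1 x)).
rewrite ge0_integralD//; first last.
- exact: measurable_funeM.
- by move=> x _; rewrite -EFinM lee_fin mulr_ge0.
- by move=> x _; rewrite lee_fin.
rewrite leeD2l// ge0_integralZl_EFin//.
rewrite integral_bool// EFinM lee_wpmul2l// ?lee_fin//.
by rewrite (_ : [set x | b x] = E)//; apply/seteqP; split=> x /asboolP.
Qed.

(* The orbit pattern of a factor of a Bernoulli shift is approximated by a
   pattern that reads finitely many coordinates, and the latter is copied to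
   [X] by a colouring. *)
Lemma orbit_pattern_transfer (R : realType) (Gamma : groupType)
    (enum : nat -> Gamma) (S : {fset Gamma})
    (d : measure_display) (X : measurableType d) (mu : probability X R)
    (f : Gamma -> X -> X)
    (e : measure_display) (Y : measurableType e) (nu : probability Y R)
    (g : Gamma -> Y -> Y) (n : nat) (B : 'I_n.+1 * 'I_n.+1 -> set Y) (eps : R) :
  pmp_action mu f -> free_action mu f -> pmp_action nu g ->
  bernoulli_factor nu g -> (forall t, measurable (B t)) -> (0 < eps)%R ->
  exists2 B' : 'I_n.+1 * 'I_n.+1 -> set X, (forall t, measurable (B' t)) &
    \int[mu]_x (pattern_cost R enum S (orbit_pattern enum f B' x))%:E <=
    \int[nu]_y (pattern_cost R enum S (orbit_pattern enum g B y))%:E + eps%:E.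
Proof.
move=> actf freef actg [e' [K [kappa [P [_ Pprod facP]]]]] mB eps0.
have [phi [mphi Pphi _ [N [mN PN0 equivN]]]] := facP.
pose T : finType := ('I_n.+1 * 'I_n.+1)%type.
pose V : finType := 'I_n.+1.
pose M := pattern_bound R S n.
have costM (b : pattern n) : (0 <= pattern_cost R enum S b <= M)%R.
  exact: pattern_cost_bound.
have cost0 (b : pattern n) : (0 <= pattern_cost R enum S b)%R.
  by case/andP: (costM b).
have M0 : (0 <= M)%R.
  by have /andP[+] := costM [ffun=> false]; exact: le_trans.
pose k : R := #|{: V * T}|%:R%R.
(* There are [k] exceptional sets of measure at most [delta], each point of which costs at most [M]:
   in total at most [eps / 2]. *)
pose delta : R := (eps / 2 / (M * k + 1))%R.
have Mk0 : (0 <= M * k)%R by rewrite mulr_ge0.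
have delta0 : (0 < delta)%R by rewrite !divr_gt0// ltr_wpDl.
pose sh (v : V) : product_space Gamma K -> product_space Gamma K :=
  @bernoulli_shift Gamma K (enum v).
have msh v : measurable_fun setT (sh v) by exact: bernoulli_shift_measurable.
pose C t : set (product_space Gamma K) := phi @^-1` B t.
have mC t : measurable (C t).
  by rewrite /C -[X in measurable X]setTI; exact: mphi.
have /choice [L HL] (t : T) := measurable_locally_approximable P msh (mC t)
  delta0.
have {HL} /choice [E HE] : forall t, exists E, [/\ measurable E,
    forall v, P (sh v @^-1` E) <= delta%:E &
    forall w, ~ E w -> (C t w <-> local_mem (L t) w)] by [].
(* Joint labels, so that one colouring serves all the edge sets together. *)
pose I : finType := {dffun forall t : T, label_type (L t)}.
pose i0 : I := [ffun t => label0 (L t)].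
pose q (x : K) : I := [ffun t => label (L t) x].
have mq : measurable_fibers q.
  by apply: measurable_fibers_dffun => t; exact: label_measurable.
(* The coordinate [h] of the shift of [w] by [enum v] is [w (h * enum v)]; this accounts for the
   right translates here and in [W]. *)
pose pat (a : Gamma -> I) : pattern n :=
  [ffun vt : V * T => local_pred (L vt.2) (fun h => a (h * enum vt.1)%g vt.2)].
pose W : {fset Gamma} := (\bigcup_(vt <- enum_mem (mem [set: V * T]%SET))
  [fset (h * enum vt.1)%g | h in local_support (L vt.2)])%fset.
have patW : depends_on W pat.
  move=> a b ab; apply/ffunP => -[v t]; rewrite !ffunE /=.
  apply: local_pred_dep => h hL; rewrite ab//.
  apply/bigfcupP; exists (v, t); first by rewrite mem_enum inE.
  by apply/imfsetP; exists h.
have costW : depends_on W (fun a => pattern_cost R enum S (pat a)).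
  by move=> a b /patW ->.
have eps20 : (0 < eps / 2)%R by rewrite divr_gt0.
have [l ml hl] := free_action_colouring actf freef i0 Pprod mq costW
  (fun a => costM (pat a)) eps20.
pose B' t := [set x | local_pred (L t) (fun h => l (f h x) t)].
exists B' => [t|].
  have mF h : measurable_fibers (fun x => l (f h x) t).
    exact: (measurable_fibers_comp (fun i : I => i t)
      (measurable_fibers_precomp (pmp_measurable actf h) ml)).
  exact: (depends_on_fibers (label0 (L t)) mF (local_pred_dep (L t)) true).
have patX x : orbit_pattern enum f B' x = pat (fun h => l (f h x)).
  apply/ffunP => -[v t]; rewrite !ffunE /= /B' asboolb.
  by congr (local_pred (L t) _); apply/funext => h; rewrite (pmp_mul actf).
under eq_integral do rewrite patX.
apply: (le_trans hl); rewrite [in leRHS](splitr eps) EFinD addeA leeD2r//.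
have mop := orbit_pattern_measurable enum (pmp_measurable actg) mB.
rewrite -(integral_factor mphi Pphi mop cost0).
have shE (vt : V * T) : measurable (sh vt.1 @^-1` E vt.2).
  rewrite -[X in measurable X]setTI; apply: msh => //.
  by have [] := HE vt.2.
(* Off [bad] the map [phi] is equivariant and all local approximations are exact at the translates
   read. *)
pose bad := N `|` \big[setU/set0]_(vt : V * T) (sh vt.1 @^-1` E vt.2).
have mbad : measurable bad.
  by apply: measurableU => //; exact: bigsetU_measurable.
have Pbad : P bad <= (k * delta)%:E.
  apply: (@le_trans _ _ (P N + P (\big[setU/set0]_(vt : V * T) (sh vt.1 @^-1`
    E vt.2)))).
    by apply: measureU2 => //; exact: bigsetU_measurable.
  rewrite PN0 add0e; apply: (le_trans (measure_bigsetU_le P _ shE)).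
  apply: (@le_trans _ _ (\sum_(vt : V * T) delta%:E)).
    by apply: lee_sum => vt _; have [_ + _] := HE vt.2; exact.
  by rewrite sumEFin lee_fin sumr_const -mulr_natl.
have mpat : measurable_fibers (fun w : product_space Gamma K => pat (q \o w)).
  have mF h : measurable_fibers (fun w : product_space Gamma K => q (w h)).
    exact: (measurable_fibers_precomp (@coordinate_measurable _ _ K h) mq).
  exact: (depends_on_fibers i0 mF patW).
have agree w : ~ bad w -> pat (q \o w) = orbit_pattern enum g B (phi w).
  move=> /not_orP[nN nE]; apply/ffunP => -[v t]; rewrite !ffunE /=.
  have [_ _ CL] := HE t.
  have eqv : phi (bernoulli_shift (enum v) w) = g (enum v) (phi w).
    by apply: contrapT => neq; apply: nN; apply: equivN => /= /(_ (enum v)).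
  have -> : local_pred (L t) (fun h => q (w (h * enum v)%g) t) = local_mem (L
    t) (sh v w).
    by congr (local_pred (L t) _); apply/funext => h; rewrite ffunE.
  have nEw : ~ E t (sh v w).
    move=> Ew; apply: nE; rewrite -bigcup_seq; exists (v, t) => //=.
    exact: mem_index_enum.
  by rewrite -eqv; apply/idP/asboolP => [Lw|Cw]; apply/CL.
apply: le_trans (integral_le_off_small mpat
  (measurable_fibers_precomp mphi mop) mbad costM M0 Pbad agree) _.
rewrite leeD2l// lee_fin /delta mulrA mulrCA ler_piMr ?(ltW eps20)//.
by rewrite ler_pdivrMr ?ltr_wpDl// mul1r lerDl.
Qed.

Lemma cost_le_free_factor_of_iid (R : realType) (Gamma : groupType)
    (d : measure_display) (X : measurableType d) (mu : probability X R)
    (f : Gamma -> X -> X)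
    (e : measure_display) (Y : measurableType e) (nu : probability Y R)
    (g : Gamma -> Y -> Y) :
  finitely_generated Gamma -> pmp_action mu f -> free_action mu f ->
  free_factor_of_iid nu g -> cost mu f <= cost nu g.
Proof.
move=> fg actf freef [actg freeg bernoullig].
have [enum enum0 enum_surj] := finitely_generated_enumeration fg.
have [S genS] := fg.
apply: le_ereal_inf_tmp => _ [Phi [graphPhi genPhi] ->].
apply/lee_addgt0Pr => eps eps0; rewrite (splitr eps) EFinD addeA.
(* One half of [eps] is spent on truncating the graphing of [g], the other on the transfer to
   [X]. *)
have eps20 : (0 < eps / 2)%R by rewrite divr_gt0.
have [n costn] := edge_pattern_cost S enum0 enum_surj actg graphPhi freeg
  genPhi eps20.
pose B (t : 'I_n.+1 * 'I_n.+1) := edge_set enum g Phi t.1 t.2.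
have mB t : measurable (B t) by exact: edge_set_measurable actg graphPhi _ _.
have [B' mB' costB'] :=
  orbit_pattern_transfer enum S actf freef actg bernoullig mB eps20.
apply: le_trans (cost_le_pattern_cost actf genS enum0 mB') _.
by apply: (le_trans costB'); rewrite leeD2r.
Qed.

Theorem corollary2 (R : realType) (Gamma : groupType)
    (fgGamma : finitely_generated Gamma) :
  (forall (d : measure_display) (X : measurableType d) (mu : probability X R)
          (f : Gamma -> X -> X)
          (e : measure_display) (Y : measurableType e) (nu : probability Y R)
          (g : Gamma -> Y -> Y),
     pmp_action mu f -> free_action mu f ->
     free_factor_of_iid nu g ->
     (cost mu f <= cost nu g)%E)
  /\
  (forall (d : measure_display) (X : measurableType d) (mu : probability X R)
          (f : Gamma -> X -> X)
          (e : measure_display) (Y : measurableType e) (nu : probability Y R)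
          (g : Gamma -> Y -> Y),
     free_factor_of_iid mu f -> free_factor_of_iid nu g ->
     cost mu f = cost nu g).
Proof.
split=> [d X mu f e Y nu g|d X mu f e Y nu g fX gY].
  exact: cost_le_free_factor_of_iid.
have [actf freef _] := fX; have [actg freeg _] := gY.
by apply/eqP; rewrite eq_le !cost_le_free_factor_of_iid.
Qed.
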